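(* Let $a,b,c\in\mathbb R$ with $b\ne0$ and $a+c\neq 0$, and consider the four-dimensional vector field on $\mathbb R^4$ $$f(x_1,y_1,x_2,y_2)=\begin{pmatrix} b(x_1^2-y_1^2)-(b+c)(x_1x_2-y_1y_2)\\ 2bx_1y_1-(b+c)(x_1y_2+x_2y_1)\\ a(x_2^2-y_2^2)-(a+c)(x_1x_2-y_1y_2)\\ 2ax_2y_2-(a+c)(x_1y_2+x_2y_1)\end{pmatrix}^T$$ associated with triangular billiards, which with $u=x_1+iy_1$, $v=x_2+iy_2$ is the complex vector field $F:\mathbb C^2\to\mathbb C^2$, $$F(u,v)=\left(bu^2-(b+c)uv,\ av^2-(a+c)uv\right).$$ Let $$\alpha=-\frac{(b+c)^2}{(a+c)^2},\qquad \beta=-2\frac{b+c}{a+c}+\frac{4ab}{(a+c)^2},\qquad \varphi(u,v)=\left(u-\frac{b+c}{2b}v,\ -\frac{a+c}{2b}v\right),$$ and let $\mathbb A=\mathbb A^2_1(\alpha,\beta)$, regarded as an algebra over $\mathbb C$ on $\mathbb C^2$. Then $F$ is $\varphi\mathbb A$-differentiable, and $F(w)=b\,(\varphi(w))^2$ for all $w=(u,v)\in\mathbb C^2$, where the square is taken with respect to the $\mathbb A$-product.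
   Context: $\mathbb A^2_1(\alpha,\beta)$ over $\mathbb C$ is the complex linear space $\mathbb C^2$ with canonical basis $e_1,e_2$ and the $\mathbb C$-bilinear commutative associative product $e_1e_1=e_1$, $e_1e_2=e_2e_1=e_2$, $e_2e_2=\alpha e_1+\beta e_2$, with unit $e=e_1$. For a $\mathbb C$-linear map $\varphi:\mathbb C^2\to\mathbb C^2$, a complex differentiable function $F:\mathbb C^2\to\mathbb C^2$ is $\varphi\mathbb A$-differentiable if there is a function $F'_\varphi:\mathbb C^2\to\mathbb C^2$ such that $dF_w(\xi)=F'_\varphi(w)\,d\varphi_w(\xi)$ ($\mathbb A$-product) for all $w,\xi\in\mathbb C^2$. *)

(* Defs.v *)
From HB Require Import structures.
From mathcomp Require Import all_boot all_order all_algebra.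
From mathcomp Require Import complex ring.
From mathcomp Require Import all_classical all_reals all_analysis.

Set Implicit Arguments.
Unset Strict Implicit.
Unset Printing Implicit Defensive.

Import Order.TTheory GRing.Theory Num.Theory numFieldNormedType.Exports.
Local Open Scope ring_scope.
Local Open Scope complex_scope.

Definition vec2 (K : pzRingType) (x y : K) : 'rV[K]_2 :=
  \row_(j < 2) [:: x; y]`_j.

Definition vec4 (K : pzRingType) (x y z t : K) : 'rV[K]_4 :=
  \row_(j < 4) [:: x; y; z; t]`_j.

(* A^2_1(alpha, beta): [algA_table i j] is the product of the i-th and j-th
   canonical basis vectors, indexed from 0, and [algA_mul] is the bilinear
   extension of this table. *)
Definition algA_table (K : comNzRingType) (alpha beta : K) (i j : 'I_2) : 'rV[K]_2 :=
  let e1 := delta_mx 0 0 in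
  let e2 := delta_mx 0 1 in
  if i == 0 then (if j == 0 then e1 else e2)
  else if j == 0 then e2 else alpha *: e1 + beta *: e2.

Definition algA_mul (K : comNzRingType) (alpha beta : K) (x y : 'rV[K]_2) : 'rV[K]_2 :=
  \sum_(i < 2) \sum_(j < 2) (x 0 i * y 0 j) *: algA_table alpha beta i j.

Lemma algA_mulE (K : comNzRingType) (alpha beta : K) (x y : 'rV[K]_2) :
  algA_mul alpha beta x y =
  vec2 (x 0 0 * y 0 0 + alpha * (x 0 1 * y 0 1))
       (x 0 0 * y 0 1 + x 0 1 * y 0 0 + beta * (x 0 1 * y 0 1)).
Proof.
have E : lift ord0 ord0 = 1 :> 'I_2 by apply: val_inj.
apply/rowP => k; rewrite /algA_mul !big_ord_recl !big_ord0 /algA_table /= !E !mxE /=.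
by case: k => [] [|[|]] //= ?; rewrite ?(mulr0, mulr1, addr0, add0r); ring.
Qed.

Lemma algA_mulC (K : comNzRingType) (alpha beta : K) : commutative (algA_mul alpha beta).
Proof. by move=> x y; rewrite !algA_mulE; congr vec2; ring. Qed.

Lemma algA_mulA (K : comNzRingType) (alpha beta : K) : associative (algA_mul alpha beta).
Proof. by move=> x y z; rewrite !algA_mulE !mxE /=; congr vec2; ring. Qed.

Lemma algA_mul1 (K : comNzRingType) (alpha beta : K) :
  left_id (delta_mx 0 0) (algA_mul alpha beta).
Proof.
move=> x; rewrite algA_mulE; apply/rowP => -[] [|[|]] //= H; rewrite !mxE /=.
  by rewrite mul1r mul0r mulr0 addr0; congr (x _ _); apply: val_inj.
by rewrite mul1r !mul0r mulr0 !addr0; congr (x _ _); apply: val_inj.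
Qed.

(* Stated over any numeric field K.  For K = R[i], [differentiable] is complex
   differentiability, ['d F w] is the C-linear differential, and [phi] is
   C-linear.  Staying abstract in K is what lets the normed module structure on
   'rV[K]_2 be inferred from a point of that type. *)
Definition phiA_differentiable (K : numFieldType) (alpha beta : K)
    (phi : {linear 'rV[K]_2 -> 'rV[K]_2}) (F : 'rV[K]_2 -> 'rV[K]_2) : Prop :=
  (forall w : 'rV[K]_2, differentiable F w) /\
  exists F' : 'rV[K]_2 -> 'rV[K]_2,
    forall w xi : 'rV[K]_2, 'd F w xi = algA_mul alpha beta (F' w) ('d phi w xi).

Definition billiard_field (R : realType) (a b c : R) (p : 'rV[R]_4) : 'rV[R]_4 :=
  let x1 := p 0 0 in let y1 := p 0 1 in
  let x2 := p 0 2 in let y2 := p 0 3 in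
  vec4 (b * (x1 ^+ 2 - y1 ^+ 2) - (b + c) * (x1 * x2 - y1 * y2))
       (2 * b * x1 * y1 - (b + c) * (x1 * y2 + x2 * y1))
       (a * (x2 ^+ 2 - y2 ^+ 2) - (a + c) * (x1 * x2 - y1 * y2))
       (2 * a * x2 * y2 - (a + c) * (x1 * y2 + x2 * y1)).

Definition complexify (R : realType) (p : 'rV[R]_4) : 'rV[R[i]]_2 :=
  vec2 (p 0 0 +i* p 0 1) (p 0 2 +i* p 0 3).

Definition billiard_cfield (R : realType) (a b c : R) (w : 'rV[R[i]]_2) :
    'rV[R[i]]_2 :=
  let u := w 0 0 in let v := w 0 1 in
  vec2 (b%:C * u ^+ 2 - (b + c)%:C * (u * v))
       (a%:C * v ^+ 2 - (a + c)%:C * (u * v)).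

Definition billiard_phi (R : realType) (a b c : R) (w : 'rV[R[i]]_2) :
    'rV[R[i]]_2 :=
  let u := w 0 0 in let v := w 0 1 in
  vec2 (u - ((b + c) / (2 * b))%:C * v) (- ((a + c) / (2 * b))%:C * v).

Fact billiard_phi_linear (R : realType) (a b c : R) : linear (billiard_phi a b c).
Proof.
by move=> k x y; apply/rowP => -[] [|[|]] //= ?; rewrite !mxE /=; ring.
Qed.

HB.instance Definition _ (R : realType) (a b c : R) :=
  GRing.isLinear.Build R[i] 'rV[R[i]]_2 'rV[R[i]]_2 *:%R (billiard_phi a b c)
    (billiard_phi_linear a b c).

Definition billiard_alpha (R : realType) (a b c : R) : R :=
  - ((b + c) ^+ 2 / (a + c) ^+ 2).

Definition billiard_beta (R : realType) (a b c : R) : R :=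
  - 2 * ((b + c) / (a + c)) + 4 * a * b / (a + c) ^+ 2.

(* Main.v *)
(** The identity F = b phi^2 is a direct computation.  Since the product is bilinear
    and commutative, the chain rule then gives dF_w = 2 b phi(w) dphi_w, so
    F'_phi = 2 b phi. *)

Require Import Defs.
From HB Require Import structures.
From mathcomp Require Import all_boot all_order all_algebra.
From mathcomp Require Import complex ring.
From mathcomp Require Import all_classical all_reals all_analysis.
Import Order.TTheory GRing.Theory Num.Theory numFieldNormedType.Exports.
Local Open Scope ring_scope.
Local Open Scope complex_scope.

Set Implicit Arguments.
Unset Strict Implicit.
Unset Printing Implicit Defensive.

(** In the algebra the field is a constant times a square, [b * phi ^ 2]. For a linear [phi], the
    Leibniz rule and commutativity turn the differential of such a square into an algebra multiple
    of [phi xi]: this is [phiA_differentiable_sqr]. Its analytic input is the continuity of [phi]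
    and of the product, which are given by polynomials in finitely many coordinates. *)

Lemma continuous_sum (K : numFieldType) (T : topologicalType)
    (V : normedModType K) (I : finType) (f : I -> T -> V) :
  (forall i, continuous (f i)) -> continuous (fun x => \sum_i f i x).
Proof.
move=> fc x; rewrite /continuous_at; elim: (index_enum I) => [|i s IHs].
  by under eq_fun do rewrite big_nil; rewrite big_nil; exact: cvg_cst.
by under eq_fun do rewrite big_cons; rewrite big_cons; exact: cvgD (fc i x) IHs.
Qed.

(** Expanding [w] in the canonical basis writes [f w] as a finite sum of coordinates of [w] times
    fixed vectors. *)
Lemma linear_rV_continuous (K : numFieldType) (n : nat) (V : normedModType K)
    (f : {linear 'rV[K]_n -> V}) : continuous f.
Proof.
have -> : (f : _ -> _) = fun w : 'rV[K]_n => \sum_i w 0 i *: f (delta_mx 0 i).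
  apply/funext => w; rewrite {1}(row_sum_delta w) linear_sum.
  by apply: eq_bigr => i _; rewrite linearZ.
apply: continuous_sum => i w; apply: (@cvgZr_tmp _ _ _ (nbhs w)).
exact: coord_continuous.
Qed.

Lemma algA_mul_is_bilinear (K : numFieldType) (alpha beta : K) :
  bilinear_for
    (GRing.Scale.Law.clone _ _ *:%R _) (GRing.Scale.Law.clone _ _ *:%R _)
    (algA_mul alpha beta).
Proof.
have D k x y z : algA_mul alpha beta (k *: x + y) z
    = k *: algA_mul alpha beta x z + algA_mul alpha beta y z.
  by rewrite !algA_mulE; apply/rowP => -[] [|[|]] //= ?; rewrite !mxE /=; ring.
split=> [z k x y|x k y z]; rewrite ?D //.
by rewrite algA_mulC D !(algA_mulC _ _ x).
Qed.

HB.instance Definition _ (K : numFieldType) (alpha beta : K) :=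
  bilinear_isBilinear.Build K 'rV[K]_2 'rV[K]_2 'rV[K]_2 _ _ (algA_mul alpha beta)
    (algA_mul_is_bilinear alpha beta).

Lemma algA_mul_continuous (K : numFieldType) (alpha beta : K) :
  continuous (fun p : 'rV[K]_2 * 'rV[K]_2 => algA_mul alpha beta p.1 p.2).
Proof.
apply: continuous_sum => i; apply: continuous_sum => j p.
apply: (@cvgZr_tmp _ _ _ (nbhs p)); apply: cvgM.
  have := @cvg_comp _ _ _ fst (fun M : 'rV[K]_2 => M 0 i) _ _ _
    (@cvg_fst _ _ (nbhs p.1) (nbhs p.2) _) (@coord_continuous K 1 2 0 i p.1); exact.
have := @cvg_comp _ _ _ snd (fun M : 'rV[K]_2 => M 0 j) _ _ _
    (@cvg_snd _ _ (nbhs p.1) (nbhs p.2) _) (@coord_continuous K 1 2 0 j p.2); exact.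
Qed.

Lemma phiA_differentiable_sqr (K : numFieldType) (alpha beta k : K)
    (phi : {linear 'rV[K]_2 -> 'rV[K]_2}) :
  phiA_differentiable alpha beta phi
    (fun w => k *: algA_mul alpha beta (phi w) (phi w)).
Proof.
pose B p := algA_mul alpha beta p.1 p.2.
pose D w := fun xi => (2 * k) *: algA_mul alpha beta (phi w) (phi xi).
(* [is_diff] carries both differentiability and the value of the differential, so it yields both
   halves of the claim. *)
suff dF w : is_diff w (fun w => k *: algA_mul alpha beta (phi w) (phi w)) (D w).
  split=> [w|]; first exact: (@ex_diff _ _ _ _ _ _ _ (dF w)).
  exists (fun w => (2 * k) *: phi w) => w xi.
  have dFE := congr1 (@^~ xi) (@diff_val _ _ _ _ _ _ _ (dF w)).
  have dphiE := congr1 (@^~ xi) (diff_lin w (@linear_rV_continuous _ _ _ phi)).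
  rewrite /= in dFE dphiE; apply: (etrans dFE); rewrite dphiE /D.
  by rewrite [RHS](linearZl_LR (algA_mul alpha beta)).
have dphi : is_diff w phi phi.
  apply: DiffDef; first exact/linear_differentiable/linear_rV_continuous.
  exact/diff_lin/linear_rV_continuous.
have dB p : is_diff p B (fun q => B (p.1, q.2) + B (q.1, p.2)).
  apply: DiffDef; first exact/differentiable_bilin/algA_mul_continuous.
  exact/diff_bilin/algA_mul_continuous.
have dBphi := is_diff_comp (is_diff_pair dphi dphi) (dB (phi w, phi w)).
apply: (is_diff_eq (is_diffZ k dBphi)); apply/funext => xi.
(* The two Leibniz terms, [phi w] times [phi xi] and the reverse, coincide by commutativity; hence
   the factor 2. *)
rewrite /D /B /= fctE /= (algA_mulC _ _ (phi xi)).
by rewrite -mulr2n -scaler_nat scalerA mulrC.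
Qed.

Theorem mainTheorem7 (R : realType) (a b c : R) (hb : b != 0) (hac : a + c != 0) :
  let f := billiard_field a b c in
  let F := billiard_cfield a b c in
  let alpha := (billiard_alpha a b c)%:C in
  let beta := (billiard_beta a b c)%:C in
  let phi := billiard_phi a b c in
  [/\ forall p : 'rV[R]_4, complexify (f p) = F (complexify p),
      phiA_differentiable alpha beta phi F
    & forall w : 'rV[R[i]]_2, F w = b%:C *: algA_mul alpha beta (phi w) (phi w)].
Proof.
move=> f F alpha beta phi.
(* In the first coordinate [alpha] cancels the [v ^ 2] term left by completing the square in [u]; in
   the second, [beta] makes the coefficient of [v ^ 2] equal to [a]. *)
have Fsqr w : F w = b%:C *: algA_mul alpha beta (phi w) (phi w).
  rewrite algA_mulE /alpha /beta /billiard_alpha /billiard_beta.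
  have hb' : b%:C != 0 by rewrite fmorph_eq0.
  have hac' : a%:C + c%:C != 0 by rewrite -rmorphD fmorph_eq0.
  apply/rowP => -[] [|[|]] //= ?; rewrite !mxE /=.
    by field; rewrite ?hb' ?hac'.
  by field; rewrite ?hb' ?hac'.
split=> // [p|].
  apply/rowP => -[] [|[|]] //= ?; rewrite !mxE /=.
    by apply/eqP; rewrite eq_complex /=; apply/andP; split; apply/eqP; ring.
  by apply/eqP; rewrite eq_complex /=; apply/andP; split; apply/eqP; ring.
rewrite (funext Fsqr); exact: phiA_differentiable_sqr.
Qed.
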